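(* Let $p>1$ and let $\varphi:\mathbb{R}^n\to\mathbb{R}\cup\{+\infty\}$ be proper and lower semicontinuous, and suppose $\varphi$ satisfies the KL property with an exponent $\theta\in\big[\frac{p-1}{p},1\big)$ (at every point of $\operatorname{Dom}\partial\varphi$). Then: (a) for $\gamma>0$, the function $\Phi(x,y)=\varphi(y)+\frac{1}{p\gamma}\|x-y\|^p$ satisfies the KL property with the same exponent $\theta$; (b) if $\varphi$ is high-order prox-bounded with threshold $\gamma^{\varphi,p}>0$, then for any $\gamma\in(0,\gamma^{\varphi,p})$ the function $\varphi^p_\gamma$ satisfies the KL property with exponent $\theta$.
   Context: For a proper lsc $h$, $\partial h$ denotes the Mordukhovich (limiting) subdifferential and $\operatorname{Dom}\partial h=\{x:\partial h(x)\neq\emptyset\}$. $h$ satisfies the KL property at $\bar x\in\operatorname{Dom}\partial h$ if there are $r>0$, $\eta\in(0,+\infty]$ and a concave continuous $\phi:[0,\eta)\to[0,\infty)$ with $\phi(0)=0$, $\phi\in C^1(0,\eta)$, $\phi'>0$ on $(0,\eta)$, such that $\phi'(|h(x)-h(\bar x)|)\operatorname{dist}(0,\partial h(x))\ge1$ whenever $x\in\mathbb{B}(\bar x;r)\cap\operatorname{Dom}\partial h$ and $0<|h(x)-h(\bar x)|<\eta$; it does so with exponent $\theta\in[0,1)$ if $\phi(t)=ct^{1-\theta}$ for some $c>0$. $\varphi^p_\gamma(x):=\inf_y\big(\varphi(y)+\frac{1}{p\gamma}\|x-y\|^p\big)$; $\varphi$ is high-order prox-bounded if $\varphi^p_\gamma(x)>-\infty$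 for some $\gamma>0,x$, and the supremum of such $\gamma$ is the threshold $\gamma^{\varphi,p}$. *)

(* Defs.v *)
From HB Require Import structures.
From mathcomp Require Import all_boot all_order all_algebra.
From mathcomp Require Import all_classical all_reals all_analysis.
Set Implicit Arguments. Unset Strict Implicit. Unset Printing Implicit Defensive.
Import Order.TTheory GRing.Theory Num.Theory.
Local Open Scope classical_set_scope.
Local Open Scope ring_scope.

Section Defs.
Variable R : realType.

Definition dotv (m : nat) (u v : 'rV[R]_m) : R := \sum_(i < m) u ord0 i * v ord0 i.
Definition enorm (m : nat) (u : 'rV[R]_m) : R := Num.sqrt (dotv u u).

Definition proper_fun (m : nat) (h : 'rV[R]_m -> \bar R) : Prop :=
  (forall x, h x != -oo%E) /\ (exists x, h x \is a fin_num).

Definition lsc (m : nat) (h : 'rV[R]_m -> \bar R) : Prop :=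
  forall x (a : R), (a%:E < h x)%E ->
    exists2 d : R, 0 < d & forall y, enorm (y - x) < d -> (a%:E < h y)%E.

Definition frechet_subdiff (m : nat) (h : 'rV[R]_m -> \bar R) (x : 'rV[R]_m) :
    set 'rV[R]_m :=
  [set v | h x \is a fin_num /\
     forall e : R, 0 < e -> exists2 d : R, 0 < d & forall y, enorm (y - x) < d ->
       (h x + (dotv v (y - x) - e * enorm (y - x))%:E <= h y)%E].

Definition lsubdiff (m : nat) (h : 'rV[R]_m -> \bar R) (x : 'rV[R]_m) :
    set 'rV[R]_m :=
  [set v | h x \is a fin_num /\
     exists (xk vk : nat -> 'rV[R]_m),
       (forall k, frechet_subdiff h (xk k) (vk k)) /\
       (forall e : R, 0 < e -> exists N, forall k, (N <= k)%N ->
          [/\ enorm (xk k - x) < e, enorm (vk k - v) < e &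
              `|fine (h (xk k)) - fine (h x)| < e])].

Definition Dom_subdiff (m : nat) (h : 'rV[R]_m -> \bar R) : set 'rV[R]_m :=
  [set x | lsubdiff h x !=set0].

Definition dist0_subdiff (m : nat) (h : 'rV[R]_m -> \bar R) (x : 'rV[R]_m) : R :=
  inf [set enorm v | v in lsubdiff h x].

(* KL property at xbar with exponent theta: desingularizing function
   phi(t) = c t^(1-theta), whose derivative is phi'(t) = c (1-theta) t^(-theta). *)
Definition KL_exponent_at (m : nat) (h : 'rV[R]_m -> \bar R) (theta : R)
    (xbar : 'rV[R]_m) : Prop :=
  exists (r : R) (eta : \bar R) (c : R), [/\ 0 < r, (0 < eta)%E, 0 < c &
    forall x, enorm (x - xbar) <= r -> Dom_subdiff h x ->
      let t := `|fine (h x) - fine (h xbar)| in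
      0 < t -> (t%:E < eta)%E ->
      1 <= (c * (1 - theta) * t `^ (- theta)) * dist0_subdiff h x].

Definition KL_exponent (m : nat) (h : 'rV[R]_m -> \bar R) (theta : R) : Prop :=
  forall xbar, Dom_subdiff h xbar -> KL_exponent_at h theta xbar.

Definition Phi_fun (n : nat) (phi : 'rV[R]_n -> \bar R) (p gamma : R)
    (z : 'rV[R]_(n + n)) : \bar R :=
  (phi (rsubmx z) + ((enorm (lsubmx z - rsubmx z)) `^ p / (p * gamma))%:E)%E.

Definition moreau_env (n : nat) (phi : 'rV[R]_n -> \bar R) (p gamma : R)
    (x : 'rV[R]_n) : \bar R :=
  ereal_inf [set (phi y + ((enorm (x - y)) `^ p / (p * gamma))%:E)%E | y in setT].

Definition hop_bounded (n : nat) (phi : 'rV[R]_n -> \bar R) (p : R) : Prop :=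
  exists (gamma : R) (x : 'rV[R]_n), 0 < gamma /\ (-oo < moreau_env phi p gamma x)%E.

Definition hop_threshold (n : nat) (phi : 'rV[R]_n -> \bar R) (p : R) : \bar R :=
  ereal_sup [set gamma%:E | gamma in
     [set g : R | 0 < g /\ exists x, (-oo < moreau_env phi p g x)%E]].

End Defs.

(* Main.v *)
Require Import Defs.
From mathcomp Require Import all_boot all_order all_algebra.
From mathcomp Require Import all_classical all_reals all_analysis.
From mathcomp Require Import ring lra.
Set Implicit Arguments. Unset Strict Implicit.
Import Order.TTheory GRing.Theory Num.Theory.
Import numFieldNormedType.Exports.
Local Open Scope classical_set_scope.
Local Open Scope ring_scope.

(* It suffices to bound Frechet subgradients near the reference point from below,
   since such a bound passes to limiting subgradients. Write [u] for [x - y].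

   No differentiability of the penalty [|u|^p / (p gamma)] is used. If [(g1, g2)]
   is a Frechet subgradient of [Phi] at [(x, y)], translating [x] and [y] together
   leaves the penalty unchanged, so [g1 + g2] is a Frechet subgradient of [phi] at
   [y]; moving [x] alone towards [y] gives [|g1| >= |u|^(p-1) / (p gamma)]. For the
   envelope, with [y] a minimizer at [x] (attained by coercivity below the
   threshold), the same two motions show that a Frechet subgradient [v] at [x] is
   one of [phi] at [y] and that [|v| >= |u|^(p-1) / (p gamma)].

   Hence subgradients are bounded away from zero unless [u] is small, and then the
   KL inequality of [phi] controls the variation of [phi] while
   [|u|^(p theta) <= |u|^(p-1)] controls that of the penalty. *)

(** * Euclidean geometry of row vectors and attainment of infima *)

Section Euclidean.
Context {R : realType}.
Implicit Types m : nat.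

Lemma dotvC m (u v : 'rV[R]_m) : dotv u v = dotv v u.
Proof. by apply: eq_bigr => i _; rewrite mulrC. Qed.

Lemma dotvDl m (u v w : 'rV[R]_m) : dotv (u + v) w = dotv u w + dotv v w.
Proof. by rewrite /dotv -big_split; apply: eq_bigr => i _; rewrite mxE mulrDl. Qed.

Lemma dotvDr m (u v w : 'rV[R]_m) : dotv w (u + v) = dotv w u + dotv w v.
Proof. by rewrite dotvC dotvDl !(dotvC w). Qed.

Lemma dotvZl m a (u v : 'rV[R]_m) : dotv (a *: u) v = a * dotv u v.
Proof. by rewrite /dotv mulr_sumr; apply: eq_bigr => i _; rewrite mxE mulrA. Qed.

Lemma dotvZr m a (u v : 'rV[R]_m) : dotv u (a *: v) = a * dotv u v.
Proof. by rewrite dotvC dotvZl dotvC. Qed.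

Lemma dotv0l m (u : 'rV[R]_m) : dotv 0 u = 0.
Proof. by rewrite /dotv big1 // => i _; rewrite mxE mul0r. Qed.

Lemma dotv_row m1 m2 (u1 v1 : 'rV[R]_m1) (u2 v2 : 'rV[R]_m2) :
  dotv (row_mx u1 u2) (row_mx v1 v2) = dotv u1 v1 + dotv u2 v2.
Proof.
rewrite /dotv big_split_ord; congr (_ + _); apply: eq_bigr => i _.
  by rewrite !row_mxEl.
by rewrite !row_mxEr.
Qed.

Lemma dotv_ge0 m (u : 'rV[R]_m) : 0 <= dotv u u.
Proof. by apply: sumr_ge0 => i _; rewrite -expr2 sqr_ge0. Qed.

Lemma enorm_ge0 m (u : 'rV[R]_m) : 0 <= enorm u.
Proof. exact: sqrtr_ge0. Qed.
#[local] Hint Resolve enorm_ge0 : core.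

Lemma sqr_enorm m (u : 'rV[R]_m) : enorm u ^+ 2 = dotv u u.
Proof. by rewrite sqr_sqrtr // dotv_ge0. Qed.

Lemma enorm0 m : enorm (0 : 'rV[R]_m) = 0.
Proof. by rewrite /enorm dotv0l sqrtr0. Qed.

Lemma enormZ m a (u : 'rV[R]_m) : enorm (a *: u) = `|a| * enorm u.
Proof. by rewrite /enorm dotvZl dotvZr mulrA -expr2 sqrtrM ?sqr_ge0 // sqrtr_sqr. Qed.

Lemma enormN m (u : 'rV[R]_m) : enorm (- u) = enorm u.
Proof. by rewrite -scaleN1r enormZ normrN1 mul1r. Qed.

Lemma enormBC m (u v : 'rV[R]_m) : enorm (u - v) = enorm (v - u).
Proof. by rewrite -opprB enormN. Qed.

Lemma ler_coord_enorm m (u : 'rV[R]_m) i : `|u ord0 i| <= enorm u.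
Proof.
rewrite -[leLHS]sqrtr_sqr ler_sqrt ?dotv_ge0 // /dotv (bigD1 i) //= -expr2 lerDl.
by apply: sumr_ge0 => j _; rewrite -expr2 sqr_ge0.
Qed.

Lemma enorm_eq0 m (u : 'rV[R]_m) : enorm u = 0 -> u = 0.
Proof.
move=> u0; apply/rowP => i; apply/eqP; rewrite mxE -normr_eq0 eq_le normr_ge0 andbT.
by rewrite -u0; exact: ler_coord_enorm.
Qed.

(** Cauchy-Schwarz: expand the square of [|v| u - |u| v] and cancel [|u| |v|]. *)
Lemma dotv_le m (u v : 'rV[R]_m) : dotv u v <= enorm u * enorm v.
Proof.
have [u0|u0] := eqVneq (enorm u) 0.
  by rewrite (enorm_eq0 u0) dotv0l enorm0 mul0r.
have [v0|v0] := eqVneq (enorm v) 0.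
  by rewrite (enorm_eq0 v0) dotvC dotv0l enorm0 mulr0.
have up : 0 < enorm u by rewrite lt_def u0 enorm_ge0.
have vp : 0 < enorm v by rewrite lt_def v0 enorm_ge0.
have := dotv_ge0 (enorm v *: u - enorm u *: v).
rewrite -scaleN1r !(dotvDl, dotvDr, dotvZl, dotvZr) (dotvC v u) -!sqr_enorm.
set a := enorm u in up *; set b := enorm v in vp *; set c := dotv u v => H.
rewrite -(ler_pM2l (mulr_gt0 up vp)); nra.
Qed.

Lemma enormD m (u v : 'rV[R]_m) : enorm (u + v) <= enorm u + enorm v.
Proof.
rewrite -(ler_pXn2r (n := 2)) ?nnegrE ?addr_ge0 // sqr_enorm sqrrD !sqr_enorm.
rewrite !(dotvDl, dotvDr) (dotvC v u) mulr2n.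
by have := dotv_le u v; lra.
Qed.

Lemma enorm_dist m (y x z : 'rV[R]_m) :
  enorm (x - z) <= enorm (x - y) + enorm (y - z).
Proof. by rewrite (le_trans _ (enormD _ _)) // addrA subrK. Qed.

Lemma enorm_row m1 m2 (u : 'rV[R]_m1) (v : 'rV[R]_m2) :
  enorm (row_mx u v) <= enorm u + enorm v.
Proof.
rewrite -(ler_pXn2r (n := 2)) ?nnegrE ?addr_ge0 // sqr_enorm sqrrD !sqr_enorm dotv_row.
by have := mulr_ge0 (enorm_ge0 u) (enorm_ge0 v); rewrite mulr2n; lra.
Qed.

Lemma enorm_rowl m1 m2 (z : 'rV[R]_(m1 + m2)) : enorm (lsubmx z) <= enorm z.
Proof.
rewrite -{2}(hsubmxK z) ler_sqrt ?dotv_ge0 // dotv_row lerDl; exact: dotv_ge0.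
Qed.

Lemma enorm_rowr m1 m2 (z : 'rV[R]_(m1 + m2)) : enorm (rsubmx z) <= enorm z.
Proof.
rewrite -{2}(hsubmxK z) ler_sqrt ?dotv_ge0 // dotv_row lerDr; exact: dotv_ge0.
Qed.

(** The ambient topology is that of the sup norm: coordinates of size at most [d / (m + 1)] give
    norm at most [sqrt m * d / (m + 1) < d]. The successor covers [m = 0]. *)
Lemma enorm_ball m (x : 'rV[R]_m) (d : R) : 0 < d ->
  nbhs x [set y | enorm (y - x) < d].
Proof.
move=> d0; have k0 : 0 < m.+1%:R :> R by rewrite ltr0n.
have e0 : 0 < d / m.+1%:R by rewrite divr_gt0.
apply: filterS (nbhsx_ballx x _ e0) => y [_ xy] /=.
have h i : `|(y - x) ord0 i| <= d / m.+1%:R.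
  by rewrite !mxE distrC ltW //; exact: (xy ord0 i).
have : enorm (y - x) <= Num.sqrt (\sum_(i < m) (d / m.+1%:R) ^+ 2).
  rewrite ler_sqrt; last by apply: sumr_ge0 => i _; rewrite sqr_ge0.
  apply: ler_sum => i _; rewrite -expr2 -[leLHS]real_normK ?num_real //.
  by rewrite lerXn2r ?nnegrE ?(ltW e0) // h.
move=> /le_lt_trans; apply.
rewrite sumr_const card_ord -[ltRHS]ger0_norm ?ltW // -sqrtr_sqr ltr_sqrt ?exprn_gt0 //.
rewrite -[ltLHS]mulr_natl expr_div_n mulrA ltr_pdivrMr ?exprn_gt0 // mulrC.
rewrite ltr_pM2l ?exprn_gt0 // -natrX ltr_nat expnS expn1 mulSn.
by rewrite (@leq_trans m.+1) // leq_addr.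
Qed.

Lemma enorm_compact m (x : 'rV[R]_m) (rho : R) (F : set_system 'rV[R]_m) :
  ProperFilter F -> F [set y | enorm (x - y) <= rho] -> cluster F !=set0.
Proof.
move=> FF Frho.
have [] := @rV_compact R m (fun i => `[x ord0 i - rho, x ord0 i + rho]%classic)
  (fun i => @segment_compact R _ _) F FF.
  apply: filterS Frho => y /= yr i.
  rewrite in_itv /= -ler_distl; apply: le_trans yr; rewrite distrC.
  by have := ler_coord_enorm (x - y) i; rewrite !mxE.
by move=> y [_ cy]; exists y.
Qed.

(** Direct method: strict sublevel sets above the infimum generate a filter, which clusters because
    the one at level [b] is bounded; by lower semicontinuity a cluster point is a minimizer. *)
Lemma lsc_inf_attained m (f : 'rV[R]_m -> \bar R) (x : 'rV[R]_m) (b rho : R) :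
  lsc f -> ereal_inf (range f) \is a fin_num -> (ereal_inf (range f) < b%:E)%E ->
  (forall y, (f y < b%:E)%E -> enorm (x - y) <= rho) ->
  exists y, f y = ereal_inf (range f).
Proof.
move=> flsc ffin infb fb; set i := ereal_inf _ in ffin infb *.
pose F := [set A | exists2 c, (i < c)%E & [set y | (f y < c)%E] `<=` A].
have FF : ProperFilter F.
  split; first by move=> [c /ereal_inf_lt[_ [y _ <-] yc]] /(_ y yc).
  split; first by exists b%:E.
  - move=> A B [c ic cA] [d id dB]; exists (Order.min c d); first by rewrite lt_min ic.
    by move=> y /=; rewrite lt_min => /andP[yc yd]; split; [exact: cA|exact: dB].
  - by move=> A B AB [c ic cA]; exists c => //; exact: subset_trans AB.
have [y cy] : cluster F !=set0.
  by apply: (enorm_compact (x := x) (rho := rho)) => //; exists b%:E.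
exists y; apply/eqP; rewrite eq_le ereal_inf_lbound ?andbT; last by exists y.
rewrite leNgt; apply/negP => iy.
(* For a level [a] strictly between, [f > a] near [y], yet [f < a] belongs to the filter. *)
have [a ia ay] : exists2 a : R, (i < a%:E)%E & (a%:E < f y)%E.
  move: iy; rewrite -(fineK ffin); case: (f y) => [r| |]//.
    by rewrite lte_fin => ir; exists ((fine i + r) / 2); rewrite lte_fin; lra.
  by move=> _; exists (fine i + 1); rewrite ?ltry // lte_fin; lra.
have [d d0 dy] := flsc _ _ ay.
have Fa : F [set z | (f z < a%:E)%E] by exists a%:E.
have [z [/= za /dy]] := cy _ _ Fa (enorm_ball y d0).
by move=> /lt_trans /(_ za); rewrite ltxx.
Qed.

End Euclidean.

#[local] Hint Extern 0 (is_true (0 <= enorm _)) => exact: enorm_ge0 : core.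

(** * Inequalities for real powers *)

Section Powers.
Context {R : realType}.
Implicit Types a b s t u p theta : R.

Lemma powR_le a b p : 0 <= p -> 0 <= a -> a <= b -> a `^ p <= b `^ p.
Proof.
by move=> p0 a0 ab; apply: ge0_ler_powR; rewrite ?nnegrE //; exact: le_trans ab.
Qed.

Lemma powR_pred u p : 1 < p -> 0 <= u -> u `^ p = u * u `^ (p - 1).
Proof.
move=> p1; rewrite le_eqVlt => /predU1P[<-|u0].
  by rewrite !powR0 ?mul0r //; lra.
rewrite -{2}(powRr1 (ltW u0)) -powRD ?(gt_eqF u0) ?implybT //; congr (_ `^ _); lra.
Qed.

(** If [a <= b], the sum is at most [2 b], and [2^theta <= 2]. The crude factor is absorbed into the
    KL constant. *)
Lemma powR_subadd a b theta : 0 <= theta <= 1 -> 0 <= a -> 0 <= b ->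
  (a + b) `^ theta <= 2 * (a `^ theta + b `^ theta).
Proof.
move=> /andP[t0 t1].
wlog ab : a b / a <= b => [H a0 b0|a0 b0].
  have [/H|/ltW /H] := leP a b; first exact.
  by rewrite addrC [b `^ _ + _]addrC; exact.
apply: (@le_trans _ _ ((2 * b) `^ theta)); first by apply: powR_le; lra.
rewrite powRM // ler_pM ?powR_ge0 ?lerDr ?powR_ge0 //.
by rewrite -[leRHS]powRr1 // ler_powR // ler1n.
Qed.

Lemma powR_concave_scale s t theta : 0 <= theta <= 1 -> 0 < s <= 1 -> 0 <= t ->
  s * t `^ theta <= (s * t) `^ theta.
Proof.
move=> /andP[t0 t1] s01 tp; have /andP[s0 s1] := s01.
rewrite powRM ?(ltW s0) // ler_wpM2r ?powR_ge0 //.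
by rewrite -[leLHS](powRr1 (ltW s0)) ger_powR.
Qed.

Lemma powR_convex_scale s t p : 1 <= p -> 0 <= s <= 1 -> 0 <= t ->
  (s * t) `^ p <= s * t `^ p.
Proof.
move=> p1 /andP[s0 s1] t0; rewrite powRM // ler_wpM2r ?powR_ge0 //.
move: s0; rewrite le_eqVlt => /predU1P[<-|s0]; first by rewrite powR0 //; lra.
by rewrite -[leRHS](powRr1 (ltW s0)) ger_powR // s0.
Qed.

(** For [a >= 0], every [s] above the root [a^(1/p)] has [s^p > a]. This serves the lower
    semicontinuity of the penalty. *)
Lemma powR_lsc a u p : 0 < p -> 0 <= u -> a < u `^ p ->
  exists2 d, 0 < d & forall s, u - d < s -> 0 <= s -> a < s `^ p.
Proof.
move=> p0 u0 au; have [a0|a0] := ltP a 0.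
  by exists 1 => // s _ _; exact: lt_le_trans (powR_ge0 _ _).
have ap : (a `^ p^-1) `^ p = a by rewrite -powRrM mulVf ?gt_eqF // powRr1.
have av : a `^ p^-1 < u.
  by rewrite ltNge; apply: contraTN au => /(powR_le (ltW p0) u0); rewrite ap -leNgt.
exists (u - a `^ p^-1) => [|s]; first by rewrite subr_gt0.
rewrite opprB addrC subrK => as_ s0; rewrite -{1}ap.
by apply: gt0_ltr_powR; rewrite ?nnegrE ?powR_ge0.
Qed.

End Powers.

(** * The KL inequality in terms of Frechet subgradients *)

Section Subgradients.
Context {R : realType}.
Implicit Types p q theta : R.

Lemma frechet_lsubdiff m (h : 'rV[R]_m -> \bar R) x v :
  frechet_subdiff h x v -> lsubdiff h x v.
Proof.
move=> hv; split; first by case: hv.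
exists (fun=> x), (fun=> v); split=> // e e0; exists 0%N => k _.
by rewrite !subrr enorm0 normr0.
Qed.

Lemma dist0_subdiff_le m (h : 'rV[R]_m -> \bar R) x v :
  lsubdiff h x v -> dist0_subdiff h x <= enorm v.
Proof.
move=> hv; apply: ge_inf; last by exists v.
by exists 0 => _ [w _ <-]; exact: enorm_ge0.
Qed.

(* The inequality is first extended to limiting subgradients: along a sequence
   realizing one of them, function values and norms converge. *)
Lemma KL_exponent_at_frechet m (h : 'rV[R]_m -> \bar R) theta xbar (r eta C : R) :
  0 < r -> 0 < eta -> 0 < C -> 0 <= theta < 1 ->
  (forall x v, enorm (x - xbar) < r -> frechet_subdiff h x v ->
     `|fine (h x) - fine (h xbar)| < eta ->
     C * `|fine (h x) - fine (h xbar)| `^ theta <= enorm v) ->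
  KL_exponent_at h theta xbar.
Proof.
move=> r0 eta0 C0 /andP[th0 th1] H.
have th1' : 0 < 1 - theta by lra.
(* The constant cancels the factor [1 - theta] of the derivative, leaving [C t^theta <= dist].
   Halving [r] keeps the approximating points in the original ball. *)
exists (r / 2), eta%:E, (C * (1 - theta))^-1; split; rewrite ?lte_fin ?divr_gt0 //.
  by rewrite invr_gt0 mulr_gt0.
move=> x xr [v0 hv0] /=; set t := `|_| => t0; rewrite lte_fin => teta.
have tp : 0 < t `^ theta by exact: powR_gt0.
suff: C * t `^ theta <= dist0_subdiff h x.
  have -> : (C * (1 - theta))^-1 * (1 - theta) * t `^ (- theta) = (C * t `^ theta)^-1.
    by rewrite powRN; field; rewrite !gt_eqF.
  by move=> D; rewrite [leRHS]mulrC ler_pdivlMr ?mulr_gt0 // mul1r.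
apply: lb_le_inf; first by exists (enorm v0), v0.
move=> _ [v [_ [xk [vk [hk lk]]]] <-]; rewrite leNgt; apply/negP => vt.
set B := C * _ in vt; have B0 : 0 < B by rewrite mulr_gt0.
set b := enorm v in vt; have b0 : 0 <= b by exact: enorm_ge0.
(* If [b < B], then [l B] is their midpoint. Far along the sequence [|vk| < l B], while the
   hypothesis at a variation above [l t] forces [|vk| >= C (l t)^theta >= l B]. *)
pose l := (B + b) / (2 * B).
have lB : l * B = (B + b) / 2 by rewrite /l; field; rewrite gt_eqF.
have l0 : 0 < l by rewrite divr_gt0; lra.
have l1 : l < 1 by rewrite ltr_pdivrMr; lra.
(* These tolerances give, in order: [xk] in the ball, [|vk|] below the midpoint, variation above
   [l t], variation below [eta]. *)
pose e := Num.min (Num.min (r / 2) ((B - b) / 2)) (Num.min ((1 - l) * t) (eta - t)).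
have e0 : 0 < e.
  rewrite !lt_min; apply/andP; split; apply/andP; split; try by lra.
  by apply: mulr_gt0; lra.
have [N /(_ N (leqnn N)) []] := lk _ e0.
rewrite !lt_min => /andP[/andP[x1 _] _] /andP[/andP[_ v1] _] /andP[_ /andP[h1 h2]].
have vN : enorm (vk N) < (B + b) / 2.
  by have := enorm_dist v (vk N) 0; rewrite !subr0 -/b; lra.
set s := `|fine (h (xk N)) - fine (h xbar)|.
have [s1 s2] : l * t < s /\ s < eta.
  have := ler_distD (fine (h x)) (fine (h (xk N))) (fine (h xbar)).
  have := ler_distD (fine (h (xk N))) (fine (h x)) (fine (h xbar)).
  rewrite [`|fine (h x) - fine (h (xk N))|]distrC -/s -/t; lra.
have /H : enorm (xk N - xbar) < r by have := enorm_dist x (xk N) xbar; lra.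
move=> /(_ _ (hk N) s2); rewrite -/s leNgt => /negP; apply.
apply: (lt_le_trans vN); rewrite -lB /B mulrCA ler_pM2l //.
apply: (@le_trans _ _ ((l * t) `^ theta)).
  by apply: powR_concave_scale; lra.
by apply: powR_le => //; [rewrite mulr_ge0 ?ltW|rewrite ltW].
Qed.

(** The form in which the hypothesis on [phi] is applied: finite [eta], no division, and zero
    variation included, since [0^theta = 0] for [theta > 0]. *)
Lemma KL_exponent_atW m (h : 'rV[R]_m -> \bar R) theta xbar :
  0 < theta < 1 -> KL_exponent_at h theta xbar ->
  exists r eta K : R, [/\ 0 < r, 0 < eta, 0 < K &
    forall x v, enorm (x - xbar) <= r -> frechet_subdiff h x v ->
      `|fine (h x) - fine (h xbar)| < eta ->
      `|fine (h x) - fine (h xbar)| `^ theta <= K * enorm v].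
Proof.
move=> /andP[th0 th1] [r [eta [c [r0 eta0 c0 H]]]].
have [e e0 ee] : exists2 e : R, 0 < e & (e%:E <= eta)%E.
  by case: eta eta0 {H} => [e|_|]//; [exists e|exists 1; rewrite ?leey].
have K0 : 0 < c * (1 - theta) by rewrite mulr_gt0 ?subr_gt0.
exists r, e, (c * (1 - theta)); split=> // x v xr hv te; have hv' := frechet_lsubdiff hv.
move: (H x xr (ex_intro _ v hv')) (normr_ge0 (fine (h x) - fine (h xbar))) => /=.
set t := `|_| in te * => Ht; rewrite le_eqVlt => /predU1P[<-|t0].
  by rewrite powR0 ?gt_eqF // mulr_ge0 ?(ltW K0).
have tp : 0 < t `^ theta by exact: powR_gt0.
have := Ht t0 (lt_le_trans (_ : t%:E < e%:E)%E ee); rewrite lte_fin powRN => /(_ te).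
rewrite mulrAC ler_pdivlMr // mul1r => /le_trans; apply.
by rewrite ler_pM2l // dist0_subdiff_le.
Qed.
End Subgradients.

(** * Subgradient bounds coming from the penalty [|u|^p / q] *)

Section Penalty.
Context {R : realType}.
Implicit Types p q theta : R.

(* Testing the inequality at [h = - s u] suffices: by convexity the penalty
   decreases by at least [s |u|^p / q]. *)
Lemma enorm_pow_subgrad p q n (u v : 'rV[R]_n) : 1 < p -> 0 < q ->
  (forall e : R, 0 < e -> exists2 d : R, 0 < d & forall h, enorm h < d ->
     dotv v h - e * enorm h <= enorm (u + h) `^ p / q - enorm u `^ p / q) ->
  enorm u `^ (p - 1) / q <= enorm v.
Proof.
move=> p_gt1 q_gt0 H; have [u0|u0] := eqVneq (enorm u) 0.
  by rewrite u0 powR0 ?mul0r // gt_eqF // subr_gt0.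
have {u0}up : 0 < enorm u by rewrite lt_def u0 enorm_ge0.
rewrite leNgt; apply/negP => vlt.
set a := enorm u `^ (p - 1) / q in vlt.
set U := enorm u in up *; set V := enorm v in vlt.
(* With slack [(a - V) / 2], dividing the tested inequality by [s U] yields [a <= V + (a - V) / 2],
   against [V < a]. The step [s] is at most 1 for convexity and satisfies [s U < d]. *)
have [|d d0 /(_ (- Num.min 1 (d / (2 * U)) *: u))] := H ((a - V) / 2); first lra.
set s := Num.min _ _; have s0 : 0 < s by rewrite lt_min ltr01 divr_gt0 // mulr_gt0.
have s1 : s <= 1 by rewrite ge_min lexx.
have sd : s * U < d.
  apply: (@le_lt_trans _ _ (d / (2 * U) * U)).
    by rewrite ler_wpM2r ?(ltW up) // ge_min lexx orbT.
  have -> : d / (2 * U) * U = d / 2 by field; rewrite gt_eqF.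
  by lra.
rewrite enormZ normrN (gtr0_norm s0) -/U => /(_ sd).
have -> : u + - s *: u = (1 - s) *: u by rewrite scalerDl scale1r.
rewrite enormZ ger0_norm ?subr_ge0 // -/U dotvZr.
have := @powR_convex_scale R (1 - s) U p; rewrite (ltW p_gt1) subr_ge0 s1 (ltW up) /=.
rewrite gerBl (ltW s0) => /(_ isT isT isT) cv.
have -> : U `^ p / q = U * a by rewrite (powR_pred p_gt1 (ltW up)) mulrA.
have : ((1 - s) * U) `^ p / q <= (1 - s) * (U * a).
  rewrite ler_pdivrMr // (le_trans cv) // (powR_pred p_gt1 (ltW up)) /a.
  by rewrite le_eqVlt; apply/orP; left; apply/eqP; field; rewrite gt_eqF.
have := dotv_le v u; rewrite -/U -/V => vu c1 c2.
have : s * (U * a) <= s * (dotv v u + (a - V) / 2 * U) by lra.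
rewrite ler_pM2l // => c3.
have : U * a <= U * (V + (a - V) / 2) by lra.
by rewrite ler_pM2l //; lra.
Qed.

(** The case of displacement at least [d]: subgradients are bounded below by a positive constant,
    and [t^theta <= 1]. *)
Lemma powR_far p q (d u t N theta : R) : 1 < p -> 0 < q -> 0 < d -> d <= u -> 0 <= t <= 1 ->
  0 <= theta -> u `^ (p - 1) / q <= N -> d `^ (p - 1) / q * t `^ theta <= N.
Proof.
move=> p_gt1 q_gt0 d0 du /andP[t0 t1] th0; apply: le_trans.
have t1' : t `^ theta <= 1 by rewrite (le_trans (powR_le th0 t0 t1)) // powR1.
apply: (@le_trans _ _ (d `^ (p - 1) / q)).
  by rewrite ler_piMr // divr_ge0 ?powR_ge0 ?ltW.
rewrite ler_pM2r ?invr_gt0 // powR_le ?(ltW d0) //. move: p_gt1; clear; lra.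
Qed.

(* Here [theta >= (p-1)/p] enters, as [u^(p theta) <= u^(p-1)] for [u <= 1]. *)
Lemma KL_penalty p q n (phi : 'rV[R]_n -> \bar R) theta ybar : 1 < p -> 0 < q ->
  (p - 1) / p <= theta -> theta < 1 -> KL_exponent_at phi theta ybar ->
  exists d eta C : R, [/\ 0 < d, 0 < eta, 0 < C &
    forall y w (u N : R), enorm (y - ybar) < d -> 0 <= u < d ->
      frechet_subdiff phi y w -> enorm w <= 2 * N -> u `^ (p - 1) / q <= N ->
      `|fine (phi y) + u `^ p / q - fine (phi ybar)| < eta ->
      C * `|fine (phi y) + u `^ p / q - fine (phi ybar)| `^ theta <= N].
Proof.
move=> p_gt1 q_gt0 pth th1 KL; have p0 : 0 < p by lra.
have th0 : 0 < theta by rewrite (lt_le_trans _ pth) // divr_gt0 // subr_gt0.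
have [|r [eta [K [r0 eta0 K0 H]]]] := KL_exponent_atW _ KL; first by rewrite th0.
(* Normalized so that [(u^p / q)^theta <= D u^(p-1) / q] for [u <= 1]. *)
pose D := q^-1 `^ theta * q.
have D0 : 0 < D by rewrite mulr_gt0 // powR_gt0 ?invr_gt0.
(* The bound 1 allows comparing powers of [u]; the bound [eta / 2 * q] keeps the penalty below
   [eta / 2], so the variation of [phi] stays below [eta]. *)
pose d := Num.min (Num.min 1 r) (eta / 2 * q).
(* The constant comes from [t^theta <= 2 (t1^theta + t2^theta) <= 2 (2 K + D) N], where [t1] and
   [t2] are the variation of [phi] and the penalty. *)
exists d, (eta / 2), (2 * (2 * K + D))^-1; split.
- by rewrite !lt_min ltr01 r0 mulr_gt0 // divr_gt0.
- by rewrite divr_gt0.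
- by rewrite invr_gt0 mulr_gt0 // addr_gt0 // mulr_gt0.
move=> y w u N; rewrite !lt_min => /andP[/andP[_ yr] _].
move=> /andP[u0 /andP[/andP[u1 _] ueta]] hw wN uN tN.
set t1 := `|fine (phi y) - fine (phi ybar)|.
set t := `|_| in tN *; set t2 := u `^ p / q.
have t20 : 0 <= t2 by rewrite divr_ge0 ?powR_ge0 ?ltW.
have t2eta : t2 < eta / 2.
  rewrite ltr_pdivrMr // (le_lt_trans _ ueta) // -[leRHS]powRr1 //.
  move: u0; rewrite le_eqVlt => /predU1P[<-|u0]; first by rewrite !powR0 ?gt_eqF.
  by rewrite ger_powR ?u0 ?ltW.
have tt : t <= t1 + t2.
  by rewrite /t addrAC (le_trans (ler_normD _ _)) // (ger0_norm t20).
have t1t : t1 <= t + t2.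
  rewrite /t1 /t -[X in _ <= _ + X](ger0_norm t20) -[X in _ <= _ + X]normrN.
  apply: le_trans (ler_normD _ _); rewrite le_eqVlt; apply/orP; left; apply/eqP.
  by congr `|_|; rewrite /t2; ring.
have h1 : t1 `^ theta <= K * (2 * N).
  apply: (le_trans (H y w (ltW yr) hw _)); last by rewrite ler_pM2l.
  by rewrite -/t1; lra.
have h2 : t2 `^ theta <= D * N.
  apply: (@le_trans _ _ (D * (u `^ (p - 1) / q))); last by rewrite ler_pM2l.
  rewrite /t2 powRM ?powR_ge0 ?invr_ge0 ?(ltW q_gt0) // -powRrM.
  have -> : D * (u `^ (p - 1) / q) = u `^ (p - 1) * q^-1 `^ theta.
    by rewrite /D; field; rewrite gt_eqF.
  rewrite ler_wpM2r ?powR_ge0 //.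
  have pt : p - 1 <= p * theta by rewrite mulrC -ler_pdivrMr.
  move: u0; rewrite le_eqVlt => /predU1P[<-|u0].
    by rewrite !powR0 ?gt_eqF ?mulr_gt0 ?subr_gt0 //.
  by rewrite ger_powR // u0 ltW.
have h3 : t `^ theta <= 2 * (t1 `^ theta + t2 `^ theta).
  apply: (le_trans (powR_le (ltW th0) _ tt)); first exact: normr_ge0.
  by apply: powR_subadd; rewrite ?normr_ge0 ?(ltW th0) ?(ltW th1).
rewrite mulrC ler_pdivrMr; last by rewrite mulr_gt0 // addr_gt0 // mulr_gt0.
lra.
Qed.

End Penalty.

(** * Subgradients of the envelope and of [Phi]; existence of minimizers *)

Section Envelope.
Context {R : realType}.
Implicit Types p gamma theta : R.

Lemma moreau_env_le n (phi : 'rV[R]_n -> \bar R) p gamma x y :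
  (moreau_env phi p gamma x <= phi y + (enorm (x - y) `^ p / (p * gamma))%:E)%E.
Proof. by apply: ereal_inf_lbound; exists y. Qed.

(* Moving the base point and the minimizer together leaves the penalty
   unchanged; moving the base point alone leaves [phi] unchanged. *)
Lemma frechet_moreau_env n (phi : 'rV[R]_n -> \bar R) p gamma x y v :
  1 < p -> 0 < gamma ->
  (phi y + (enorm (x - y) `^ p / (p * gamma))%:E)%E = moreau_env phi p gamma x ->
  frechet_subdiff (moreau_env phi p gamma) x v ->
  frechet_subdiff phi y v /\ enorm (x - y) `^ (p - 1) / (p * gamma) <= enorm v.
Proof.
move=> p1 g0 yx [+ H]; rewrite -yx fin_numD => /andP[yf _].
have q0 : 0 < p * gamma by rewrite mulr_gt0 //; lra.
split.
  split=> // e e0; have [d d0 Hd] := H e e0; exists d => // y' y'y.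
  have := Hd (x + (y' - y)); rewrite (addrC x) addrK => /(_ y'y).
  move=> /le_trans /(_ (moreau_env_le phi p gamma _ y')).
  have -> : y' - y + x - y' = x - y by rewrite addrAC [y' - y]addrC addrK addrC.
  by rewrite -yx addeAC leeD2rE.
apply: enorm_pow_subgrad => // e e0; have [d d0 Hd] := H e e0; exists d => // h hd.
have := Hd (x + h); rewrite (addrC x) addrK => /(_ hd).
move=> /le_trans /(_ (moreau_env_le phi p gamma _ y)).
by rewrite -yx -addeA leeD2lE // -EFinD lee_fin -addrA (addrC h); lra.
Qed.

(** Direction [(h, h)] fixes the penalty and direction [(h, 0)] fixes the [phi] term. *)
Lemma frechet_Phi n (phi : 'rV[R]_n -> \bar R) p gamma z g :
  1 < p -> 0 < gamma -> frechet_subdiff (Phi_fun phi p gamma) z g ->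
  frechet_subdiff phi (rsubmx z) (lsubmx g + rsubmx g) /\
  enorm (lsubmx z - rsubmx z) `^ (p - 1) / (p * gamma) <= enorm (lsubmx g).
Proof.
move=> p1 g0 [+ H]; rewrite fin_numD => /andP[yf _].
have q0 : 0 < p * gamma by rewrite mulr_gt0 //; lra.
have dot_g h k : dotv g (row_mx h k) = dotv (lsubmx g) h + dotv (rsubmx g) k.
  by rewrite -{1}(hsubmxK g) dotv_row.
split.
  split=> // e e0; have [|d d0 Hd] := H (e / 2); first lra.
  exists (d / 2) => [|y' y'y]; first lra.
  set h := y' - rsubmx z in y'y *.
  have hd : enorm (row_mx h h) <= 2 * enorm h by have := enorm_row h h; lra.
  have := Hd (z + row_mx h h); rewrite (addrC z) addrK.
  have -> : (enorm (row_mx h h) < d) = true by apply/idP; lra.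
  move=> /(_ isT); rewrite /Phi_fun !linearD /= row_mxKl row_mxKr dot_g -dotvDl.
  have -> : h + lsubmx z + (- h - rsubmx z) = lsubmx z - rsubmx z.
    by rewrite addrACA subrr add0r.
  have -> : h + rsubmx z = y' by rewrite subrK.
  rewrite addeAC leeD2rE // => /(le_trans _); apply.
  by rewrite leeD2lE // lee_fin; nra.
apply: enorm_pow_subgrad => // e e0; have [d d0 Hd] := H e e0; exists d => // h hd.
have eh : enorm (row_mx h (0 : 'rV[R]_n)) = enorm h.
  by rewrite /enorm dotv_row dotv0l addr0.
have := Hd (z + row_mx h 0); rewrite (addrC z) addrK eh => /(_ hd).
rewrite /Phi_fun !linearD /= row_mxKl row_mxKr dot_g [dotv _ 0]dotvC dotv0l addr0 oppr0 !add0r.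
by rewrite -addeA leeD2lE // -EFinD lee_fin -addrA (addrC h); lra.
Qed.

(** For some [g > gamma], [phi y >= B - |x0 - y|^p / (p g)]. Far from [x], the stronger penalty at
    [gamma] dominates this loss despite the change of center. *)
Lemma coercive_of_threshold n (phi : 'rV[R]_n -> \bar R) p gamma x (b : R) :
  1 < p -> 0 < gamma -> (gamma%:E < hop_threshold phi p)%E ->
  exists rho : R, forall y,
    (phi y + (enorm (x - y) `^ p / (p * gamma))%:E < b%:E)%E -> enorm (x - y) <= rho.
Proof.
move=> p1 g0 /ereal_sup_gt[_ [g [g'0 [x0 Mx0]] <-]]; rewrite lte_fin => gg.
have [B BM] : exists B : R, (B%:E <= moreau_env phi p g x0)%E.
  case: (moreau_env phi p g x0) Mx0 => [B| |]// _; first by exists B.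
  by exists 0; rewrite leey.
have p0 : 0 < p by lra.
(* Midpoint of 1 and [g / gamma]: recentering may cost a factor [k] in [|x - y|^p] and still leave
   the coefficient [dl = 1 / (p gamma) - k / (p g) > 0]. *)
pose k := (g + gamma) / (2 * gamma).
have k1 : 1 < k by rewrite ltr_pdivlMr; lra.
pose a := k `^ p^-1.
have ak : a `^ p = k by rewrite -powRrM mulVf ?gt_eqF // powRr1 //; lra.
have a1 : 1 < a.
  rewrite ltNge; apply/negP => /(powR_le (ltW p0) (powR_ge0 _ _)).
  by rewrite ak powR1; lra.
pose dl := (g - gamma) / (2 * gamma * g) / p.
have dl0 : 0 < dl by rewrite !divr_gt0 ?mulr_gt0 // subr_gt0.
(* Beyond these three bounds, respectively, [u <= u^p], [|x0 - y| <= a u], and [dl u > b - B]. *)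
exists (Num.max (Num.max 1 (enorm (x0 - x) / (a - 1))) ((b - B) / dl)) => y.
set u := enorm (x - y) => yb; rewrite leNgt; apply/negP.
rewrite !gt_max => /andP[/andP[u1 ua] uB].
have u0 : 0 <= u by exact: enorm_ge0.
have au : enorm (x0 - y) <= a * u.
  have := enorm_dist x x0 y; rewrite -/u.
  by move: ua; rewrite ltr_pdivrMr ?subr_gt0 //; lra.
have up : u <= u `^ p by rewrite -{1}(powRr1 u0) ler_powR // ltW.
have : (B%:E < b%:E - (u `^ p / (p * gamma))%:E + (enorm (x0 - y) `^ p / (p * g))%:E)%E.
  apply: (le_lt_trans BM); apply: (le_lt_trans (moreau_env_le phi p g x0 y)).
  by rewrite lteD2rE // lteBrDr.
rewrite lte_fin => Bb.
have au' : enorm (x0 - y) `^ p / (p * g) <= k * u `^ p / (p * g).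
  rewrite ler_pM2r ?invr_gt0 ?mulr_gt0 // -ak -powRM //; last by lra.
  by apply: powR_le; rewrite // ltW.
have e1 : u `^ p / (p * gamma) - k * u `^ p / (p * g) = dl * u `^ p.
  by rewrite /k /dl; field; rewrite !gt_eqF.
have : dl * u <= dl * u `^ p by rewrite ler_pM2l.
by move: uB; rewrite ltr_pdivrMr //; lra.
Qed.

(** Direct method at the level one above the infimum, where coercivity bounds the sublevel set. *)
Lemma moreau_env_attained n (phi : 'rV[R]_n -> \bar R) p gamma x :
  1 < p -> 0 < gamma -> (forall y, phi y != -oo%E) -> lsc phi ->
  (gamma%:E < hop_threshold phi p)%E -> moreau_env phi p gamma x \is a fin_num ->
  exists y, (phi y + (enorm (x - y) `^ p / (p * gamma))%:E)%E = moreau_env phi p gamma x.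
Proof.
move=> p1 g0 phiNy philsc gth Mf.
have p0 : 0 < p by lra.
have q0 : 0 < p * gamma by rewrite mulr_gt0.
pose f y := (phi y + (enorm (x - y) `^ p / (p * gamma))%:E)%E.
have [rho Hrho] := coercive_of_threshold x (fine (moreau_env phi p gamma x) + 1) p1 g0 gth.
apply: (@lsc_inf_attained _ _ f x (fine (moreau_env phi p gamma x) + 1) rho) => //.
  move=> y a ay; set u := enorm (x - y) in ay *.
  (* Splitting [a] lets each summand use its own lower semicontinuity. For finite [phi y], each
     summand gives up half of the slack. *)
  have [b [s [by_ su bs]]] : exists b s : R,
      [/\ (b%:E < phi y)%E, s < u `^ p & a = b + s / (p * gamma)].
    move: ay; rewrite /f -/u; case: (phi y) (phiNy y) => [r| |]// _.
      rewrite -EFinD lte_fin => ay; pose e := (r + u `^ p / (p * gamma) - a) / 2.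
      exists (r - e), (u `^ p + (a - r - u `^ p / (p * gamma) + e) * (p * gamma)).
      split; first by rewrite lte_fin /e; lra.
        by rewrite gtrDl pmulr_llt0 // /e; lra.
      by field; rewrite !gt_eqF.
    move=> _; exists (a - (u `^ p - 1) / (p * gamma)), (u `^ p - 1).
    by split; [exact: ltry|lra|rewrite subrK].
  have [d1 d10 H1] := philsc _ _ by_.
  have [d2 d20 H2] := powR_lsc p0 (enorm_ge0 (x - y)) su.
  exists (Num.min d1 d2) => [|y']; first by rewrite lt_min d10.
  rewrite lt_min => /andP[/H1 y1 y2].
  have sy : s < enorm (x - y') `^ p.
    by apply: H2 => //; have := enorm_dist y' x y; rewrite -/u; lra.
  rewrite bs EFinD; apply: (lteD y1).
  by rewrite lte_fin ltr_pM2r // invr_gt0.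
by rewrite -[X in (X < _)%E](fineK Mf) lte_fin; lra.
Qed.

End Envelope.

(** * Transfer of the KL exponent to [Phi] and to the envelope *)

Section Transfer.
Context {R : realType}.
Implicit Types p gamma theta : R.

Lemma fine_Phi n (phi : 'rV[R]_n -> \bar R) p gamma z :
  Phi_fun phi p gamma z \is a fin_num ->
  fine (Phi_fun phi p gamma z) =
    fine (phi (rsubmx z)) + enorm (lsubmx z - rsubmx z) `^ p / (p * gamma).
Proof. by rewrite fin_numD => /andP[yf _]; rewrite /Phi_fun fineD. Qed.

Lemma fine_Phi_diag n (phi : 'rV[R]_n -> \bar R) p gamma z :
  0 < p -> lsubmx z = rsubmx z -> Phi_fun phi p gamma z \is a fin_num ->
  fine (Phi_fun phi p gamma z) = fine (phi (rsubmx z)).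
Proof.
by move=> p0 lr zf; rewrite fine_Phi // lr subrr enorm0 powR0 ?gt_eqF // mul0r addr0.
Qed.

Lemma enorm_lrsub n (z w : 'rV[R]_(n + n)) :
  enorm ((lsubmx z - rsubmx z) - (lsubmx w - rsubmx w)) <= 2 * enorm (z - w).
Proof.
have -> : lsubmx z - rsubmx z - (lsubmx w - rsubmx w) = lsubmx (z - w) - rsubmx (z - w).
  by rewrite !linearB /= addrACA.
have := enormD (lsubmx (z - w)) (- rsubmx (z - w)); rewrite enormN.
by have := enorm_rowl (z - w); have := enorm_rowr (z - w); lra.
Qed.

(** Puts [rsubmx z] in the domain where the KL property of [phi] is given. The penalty tends to 0
    along the sequence, so the values of [phi] converge as well. *)
Lemma lsubdiff_Phi_diag n (phi : 'rV[R]_n -> \bar R) p gamma z g :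
  1 < p -> 0 < gamma -> lsubmx z = rsubmx z ->
  lsubdiff (Phi_fun phi p gamma) z g ->
  lsubdiff phi (rsubmx z) (lsubmx g + rsubmx g).
Proof.
move=> p1 g0 lr [zf [zk [gk [hk lk]]]].
have p0 : 0 < p by lra.
have q0 : 0 < p * gamma by rewrite mulr_gt0.
split; first by move: zf; rewrite fin_numD => /andP[].
exists (fun k => rsubmx (zk k)), (fun k => lsubmx (gk k) + rsubmx (gk k)).
split=> [k|e e0]; first by case: (frechet_Phi p1 g0 (hk k)).
(* Since [u <= 2 |zk - z|], the bound 1/2 gives [u^p <= u] and the last bound gives
   [u^p / (p gamma) <= e / 2]. *)
pose e' := Num.min (Num.min (1 / 2) (e / 4)) (e / 4 * (p * gamma)).
have e'0 : 0 < e'.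
  by rewrite !lt_min; apply/andP; split; [apply/andP; split; lra|rewrite mulr_gt0 //; lra].
have [N HN] := lk _ e'0; exists N => k /HN[].
rewrite {1}/e' !lt_min => /andP[/andP[z1 z2] z3] /andP[/andP[_ g2] _] /andP[/andP[_ h2] _].
split.
- by have := enorm_rowr (zk k - z); rewrite linearB /=; lra.
- have -> : lsubmx (gk k) + rsubmx (gk k) - (lsubmx g + rsubmx g) =
            lsubmx (gk k - g) + rsubmx (gk k - g) by rewrite !linearB /= opprD addrACA.
  have := enormD (lsubmx (gk k - g)) (rsubmx (gk k - g)).
  by have := enorm_rowl (gk k - g); have := enorm_rowr (gk k - g); lra.
have [kf _] := hk k.
(* Rewriting directly would make unification compare [Phi_fun] at two points. *)
move: (fine_Phi kf) (fine_Phi_diag p0 lr zf) h2.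
generalize (fine (Phi_fun phi p gamma (zk k))) (fine (Phi_fun phi p gamma z)).
move=> _ _ -> ->.
have := enorm_lrsub (zk k) z.
have -> : lsubmx z - rsubmx z = 0 by rewrite lr subrr.
rewrite subr0.
set u := enorm (lsubmx _ - _) => u2; have u0 : 0 <= u by exact: enorm_ge0.
have up : u `^ p <= u.
  move: u0; rewrite le_eqVlt => /predU1P[<-|u0]; first by rewrite powR0 ?gt_eqF.
  by rewrite -[leRHS](powRr1 (ltW u0)) ger_powR ?u0 //; lra.
have uq : u `^ p / (p * gamma) <= e / 2 by rewrite ler_pdivrMr //; lra.
have uq0 : 0 <= u `^ p / (p * gamma) by rewrite divr_ge0 ?powR_ge0 ?ltW.
rewrite !ltr_norml => /andP[]; set P := u `^ p / _ in uq uq0 * => h1 h2.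
by apply/andP; split; lra.
Qed.

Lemma KL_exponent_Phi n (phi : 'rV[R]_n -> \bar R) p gamma theta :
  1 < p -> 0 < gamma -> (p - 1) / p <= theta -> theta < 1 ->
  KL_exponent phi theta -> KL_exponent (Phi_fun phi p gamma) theta.
Proof.
move=> p1 g0 pth th1 KL zbar [gbar hbar].
have p0 : 0 < p by lra.
have q0 : 0 < p * gamma by rewrite mulr_gt0.
have th0 : 0 <= theta by rewrite (le_trans _ pth) // divr_ge0 ?subr_ge0 ?(ltW p1) ?(ltW p0).
have [zbf _] := hbar.
have [lr|lr] := eqVneq (lsubmx zbar) (rsubmx zbar).
  have ydom := lsubdiff_Phi_diag p1 g0 lr hbar.
  have KLy := KL _ (ex_intro _ _ ydom).
  have [d [eta [C [d0 eta0 C0 H]]]] := KL_penalty p1 q0 pth th1 KLy.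
  apply: (@KL_exponent_at_frechet _ _ _ _ _ (d / 2) eta C) => //; first lra.
    by rewrite th0.
  move=> z g zd hg; have [zf _] := hg; have [hy ug] := frechet_Phi p1 g0 hg.
  move: (fine_Phi zf) (fine_Phi_diag p0 lr zbf).
  generalize (fine (Phi_fun phi p gamma z)) (fine (Phi_fun phi p gamma zbar)).
  move=> _ _ -> ->.
  apply: (H _ (lsubmx g + rsubmx g)) => //.
  - by have := enorm_rowr (z - zbar); rewrite linearB /=; lra.
  - have := enorm_lrsub z zbar.
    have -> : lsubmx zbar - rsubmx zbar = 0 by rewrite lr subrr.
    by rewrite subr0 enorm_ge0 /=; lra.
  - have := enormD (lsubmx g) (rsubmx g).
    by have := enorm_rowl g; have := enorm_rowr g; lra.
  - exact: le_trans (enorm_rowl g).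
have D0 : 0 < enorm (lsubmx zbar - rsubmx zbar).
  rewrite lt_def enorm_ge0 andbT; apply/eqP => /enorm_eq0 /eqP.
  by rewrite subr_eq0 (negPf lr).
set D := enorm _ in D0.
have D20 : 0 < D / 2 by lra.
(* Off the diagonal: within [D / 4] of [zbar] the displacement changes by at most [D / 2], so it
   stays at least [D / 2]. *)
apply: (@KL_exponent_at_frechet _ _ _ _ _ (D / 4) 1 ((D / 2) `^ (p - 1) / (p * gamma))) => //.
- by lra.
- by rewrite divr_gt0 // powR_gt0.
- by rewrite th0.
move=> z g zd hg /ltW t1; have [_ ug] := frechet_Phi p1 g0 hg.
apply: (powR_far p1 q0 D20 _ _ th0 (le_trans ug (enorm_rowl g))); last by rewrite normr_ge0.
have := enorm_lrsub z zbar; rewrite enormBC.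
have := enorm_dist (lsubmx z - rsubmx z) (lsubmx zbar - rsubmx zbar) 0.
by rewrite !subr0 -/D; lra.
Qed.

(** Here [phi y >= phi x - |x - y|^p / (p gamma)], and the penalty is [o(|x - y|)] because
    [p > 1]. *)
Lemma frechet0_of_env n (phi : 'rV[R]_n -> \bar R) p gamma x :
  1 < p -> 0 < gamma -> phi x \is a fin_num -> phi x = moreau_env phi p gamma x ->
  frechet_subdiff phi x 0.
Proof.
move=> p1 g0 xf xM; have p0 : 0 < p - 1 by lra.
have q0 : 0 < p * gamma by rewrite mulr_gt0 //; lra.
split=> // e e0.
exists ((e * (p * gamma)) `^ (p - 1)^-1) => [|y yd]; first by apply: powR_gt0; exact: mulr_gt0.
have uq : enorm (x - y) `^ p / (p * gamma) <= e * enorm (y - x).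
  rewrite enormBC (powR_pred p1) // ler_pdivrMr // mulrAC [leRHS]mulrC ler_wpM2l //.
  have := powR_le (ltW p0) (enorm_ge0 _) (ltW yd).
  by rewrite -powRrM mulVf ?gt_eqF // powRr1 // mulr_ge0 ?ltW.
have := moreau_env_le phi p gamma x y; rewrite -xM dotv0l sub0r.
rewrite -leeBlDr // => /(le_trans _); apply.
by rewrite leeD2lE // -EFinN lee_fin lerN2.
Qed.

(** Either the envelope equals [phi] at [xbar], which is then critical for [phi], or it lies
    strictly below and minimizers stay away from [xbar]. *)
Lemma KL_exponent_moreau_env n (phi : 'rV[R]_n -> \bar R) p gamma theta :
  1 < p -> 0 < gamma -> (p - 1) / p <= theta -> theta < 1 ->
  (forall y, phi y != -oo%E) -> lsc phi -> (gamma%:E < hop_threshold phi p)%E ->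
  KL_exponent phi theta -> KL_exponent (moreau_env phi p gamma) theta.
Proof.
move=> p1 g0 pth th1 phiNy philsc gth KL xbar [vbar [Mbf _]].
have p0 : 0 < p by lra.
have q0 : 0 < p * gamma by rewrite mulr_gt0.
have th0 : 0 <= theta by rewrite (le_trans _ pth) // divr_ge0 ?subr_ge0 ?(ltW p1) ?(ltW p0).
have Mle : (moreau_env phi p gamma xbar <= phi xbar)%E.
  have := moreau_env_le phi p gamma xbar xbar.
  by rewrite subrr enorm0 powR0 ?gt_eqF // mul0r adde0.
have prox x v : frechet_subdiff (moreau_env phi p gamma) x v -> exists y,
    [/\ fine (moreau_env phi p gamma x) = fine (phi y) + enorm (x - y) `^ p / (p * gamma),
        (phi y <= moreau_env phi p gamma x)%E, frechet_subdiff phi y v &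
        enorm (x - y) `^ (p - 1) / (p * gamma) <= enorm v].
  move=> hv; have [Mf _] := hv.
  have [y yx] := moreau_env_attained p1 g0 phiNy philsc gth Mf; exists y.
  have [hy uv] := frechet_moreau_env p1 g0 yx hv; have [yf _] := hy.
  by split=> //; rewrite -yx ?fineD // leeDl // lee_fin divr_ge0 ?powR_ge0 ?ltW.
move: Mle; rewrite le_eqVlt => /predU1P[/esym xM|].
  have xf : phi xbar \is a fin_num by rewrite xM.
  have KLx := KL _ (ex_intro _ _ (frechet_lsubdiff (frechet0_of_env p1 g0 xf xM))).
  have [d [eta [C [d0 eta0 C0 H]]]] := KL_penalty p1 q0 pth th1 KLx.
  have d20 : 0 < d / 2 by lra.
  pose C' := (d / 2) `^ (p - 1) / (p * gamma).
  have C'0 : 0 < C' by rewrite divr_gt0 // powR_gt0.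
  apply: (@KL_exponent_at_frechet _ _ _ _ _ (d / 2) (Num.min eta 1) (Num.min C C')) => //.
  - by rewrite lt_min eta0 /=.
  - by rewrite lt_min C0.
  - by rewrite th0.
  move=> x v xd /prox[y [yx _ hy uv]]; rewrite lt_min => /andP[teta t1].
  (* A minimizer within [d / 2] of [x] is within [d] of [xbar], where the KL inequality of [phi]
     applies; a farther one makes [|v|] large. *)
  have [yd|yd] := ltP (enorm (x - y)) (d / 2).
    apply: (@le_trans _ _ (C * `|fine (moreau_env phi p gamma x) -
        fine (moreau_env phi p gamma xbar)| `^ theta)).
      by rewrite ler_wpM2r ?powR_ge0 // ge_min lexx.
    have xM' : fine (moreau_env phi p gamma xbar) = fine (phi xbar) by rewrite xM.
    move: yx xM' teta.
    generalize (fine (moreau_env phi p gamma x)) (fine (moreau_env phi p gamma xbar)).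
    move=> _ _ -> -> teta; apply: (H y v) => //.
    - by have := enorm_dist x y xbar; rewrite (enormBC y x); lra.
    - by rewrite enorm_ge0 /=; lra.
    - by have := enorm_ge0 v; lra.
  have t01 : 0 <= `|fine (moreau_env phi p gamma x) - fine (moreau_env phi p gamma xbar)| <= 1.
    by rewrite normr_ge0 ltW.
  apply: (le_trans _ (powR_far p1 q0 d20 yd t01 th0 uv)).
  by rewrite ler_wpM2r ?powR_ge0 // ge_min lexx orbT.
(* Values of the envelope close to its value at [xbar] lie below those of [phi]
   around [xbar], so minimizers stay away from [xbar]. *)
rewrite -[X in (X < _)%E](fineK Mbf) => Mlt.
have [eta eta0 aphi] : exists2 eta : R, 0 < eta &
    ((fine (moreau_env phi p gamma xbar) + eta)%:E < phi xbar)%E.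
  move: Mlt; case: (phi xbar) (phiNy xbar) => [r| |]// _; last first.
    by exists 1; rewrite ?ltry.
  rewrite lte_fin => Mr; exists ((r - fine (moreau_env phi p gamma xbar)) / 2).
    by lra.
  by rewrite lte_fin; lra.
have [d d0 Hd] := philsc _ _ aphi.
have d20 : 0 < d / 2 by lra.
apply: (@KL_exponent_at_frechet _ _ _ _ _ (d / 2) (Num.min eta 1)
  ((d / 2) `^ (p - 1) / (p * gamma))) => //.
- by rewrite lt_min eta0 /=.
- by rewrite divr_gt0 // powR_gt0.
- by rewrite th0.
move=> x v xd hv; have [Mf _] := hv.
have [y [_ yM _ uv]] := prox _ _ hv; rewrite lt_min => /andP[teta t1].
apply: (powR_far p1 q0 d20 _ _ th0 uv); last by rewrite normr_ge0 ltW.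
(* Otherwise [y] is within [d] of [xbar], so [phi y] exceeds the envelope at [xbar] by more than
   [eta], although [phi y] is at most the envelope at [x]. *)
rewrite leNgt; apply/negP => yx.
have /Hd /lt_le_trans /(_ yM) : enorm (y - xbar) < d.
  by have := enorm_dist x y xbar; rewrite (enormBC y x); lra.
move: Mf teta.
generalize (moreau_env phi p gamma x) (fine (moreau_env phi p gamma xbar)).
by case=> // a b _; rewrite ltr_norml lte_fin /=; lra.
Qed.

End Transfer.
Unset Implicit Arguments.

Theorem theorem4 (R : realType) (n : nat) (p theta : R)
    (phi : 'rV[R]_n -> \bar R) :
  1 < p ->
  proper_fun phi -> lsc phi ->
  (p - 1) / p <= theta -> theta < 1 ->
  KL_exponent phi theta ->
  (forall gamma : R, 0 < gamma -> KL_exponent (Phi_fun phi p gamma) theta) /\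
  (hop_bounded phi p -> (0 < hop_threshold phi p)%E ->
     forall gamma : R, 0 < gamma -> (gamma%:E < hop_threshold phi p)%E ->
       KL_exponent (moreau_env phi p gamma) theta).
Proof.
move=> p1 [phiNy _] philsc pth th1 KL; split=> [gamma g0|_ _ gamma g0 gth].
  exact: KL_exponent_Phi.
exact: KL_exponent_moreau_env.
Qed.
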